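(* Let $G$ be a graph of order $n(G)$ and maximum degree $\Delta(G)\geq 3$. Then $$\gamma_e(G)\geq \left(\frac{n(G)}{13(\Delta(G)-1)^2}\right)^{\frac{\log_2(\Delta(G)-1)+1}{\log_2^2(\Delta(G)-1)+\log_2(\Delta(G)-1)+1}},$$ where $\log_2^2(x)=(\log_2 x)^2$ and $\gamma_e(G)$ is the exponential domination number of $G$.
   Context: All graphs are finite, simple, and undirected. Let $G$ be a graph and $S\subseteq V(G)$. For two vertices $u,v$ of $G$ with $u\in S$ or $v\in S$, let $\mathrm{dist}_{(G,S)}(u,v)$ be the minimum number of edges of a path $P$ in $G$ between $u$ and $v$ such that $S$ contains exactly one endvertex of $P$ and no internal vertex of $P$; if no such path exists, $\mathrm{dist}_{(G,S)}(u,v)=\infty$. (Thus $\mathrm{dist}_{(G,S)}(u,u)=0$ for $u\in S$, and $\mathrm{dist}_{(G,S)}(u,v)=\infty$ for distinct $u,v\in S$.) For a vertex $u$ of $G$, let $$w_{(G,S)}(u)=\sum_{v\in S}\left(\tfrac12\right)^{\mathrm{dist}_{(G,S)}(u,v)-1},\qquad \left(\tfrac12\right)^{\infty}=0,$$ so that $w_{(G,S)}(u)=2$ for $u\in S$. The set $S$ is an exponential dominating set of $G$ if $w_{(G,S)}(u)\geq 1$ for every vertex $u$ of $G$. The exponential domination number $\gamma_e(G)$ is the minimum order of an exponential dominating set of $G$. *)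

(* Defs.v *)
From mathcomp Require Import all_boot all_order all_algebra.
From mathcomp Require Import boolp reals exp.

Set Implicit Arguments.
Unset Strict Implicit.
Unset Printing Implicit Defensive.

Import Order.TTheory GRing.Theory Num.Theory.

Local Open Scope ring_scope.

(* A graph is a symmetric irreflexive relation e on a finite type T. *)

Definition max_degree (T : finType) (e : rel T) : nat :=
  \max_(x : T) #|[set y | e x y]|.

(* u :: p lists the vertices of a path, so size p is its number of edges.   *)
(* The one-vertex path (u = v) has a single endvertex, since [set u; u] is  *)
(* [set u].                                                                 *)
Definition admissible_path (T : finType) (e : rel T) (S : {set T}) (u v : T)
    (p : seq T) : bool :=
  [&& path e u p, last u p == v, uniq (u :: p),
      #|S :&: [set u; v]| == 1%N
    & all (fun x => (x \in [set u; v]) || (x \notin S)) (u :: p)].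

Definition admissible_length (T : finType) (e : rel T) (S : {set T}) (u v : T)
    : pred nat :=
  fun n => [exists p : n.-tuple T, admissible_path e S u v p].

(* None stands for an infinite distance. *)
Definition dist (T : finType) (e : rel T) (S : {set T}) (u v : T)
    : option nat :=
  if pselect (exists n, admissible_length e S u v n) is left h
  then Some (ex_minn h) else None.

(* The exponent is an integer: distance 0 contributes (1/2)^(-1) = 2. *)
Definition half_pow_pred (d : option nat) : rat :=
  if d is Some n then (1 / 2) ^ (n%:Z - 1) else 0.

Definition weight (T : finType) (e : rel T) (S : {set T}) (u : T) : rat :=
  \sum_(v in S) half_pow_pred (dist e S u v).

Definition exp_dominating (T : finType) (e : rel T) : pred {set T} :=
  fun S => [forall u, 1 <= weight e S u].

Lemma dist_self (T : finType) (e : rel T) (S : {set T}) (u : T) :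
  u \in S -> dist e S u u = Some 0%N.
Proof.
move=> uS; have h0 : admissible_length e S u u 0.
  apply/existsP; exists [tuple]; rewrite /admissible_path /= eqxx setUid.
  have /setIidPr -> : [set u] \subset S by rewrite sub1set.
  by rewrite cards1 !inE !eqxx.
rewrite /dist; case: pselect => [h|[]]; last by exists 0%N.
by case: ex_minnP => m _ /(_ _ h0); rewrite leqn0 => /eqP ->.
Qed.

Lemma exp_dominating_setT (T : finType) (e : rel T) :
  exp_dominating e [set: T].
Proof.
apply/forallP => u; rewrite /weight (bigD1 u) ?inE //= dist_self ?inE //.
rewrite -[leLHS]addr0 lerD //; apply: sumr_ge0 => v _.
by case: (dist _ _ _ _) => //= n; rewrite exprz_ge0.
Qed.

(* The seed [set: T] only witnesses that the minimum ranges over a nonempty *)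
(* family (exp_dominating_setT); the value does not depend on it.           *)
Definition exp_domination_number (T : finType) (e : rel T) : nat :=
  #|[arg min_(S < [set: T] | exp_dominating e S) #|S|]%N|.

Lemma exp_domination_numberP (T : finType) (e : rel T) :
  (exists2 S, exp_dominating e S & exp_domination_number e = #|S|) /\
  (forall S, exp_dominating e S -> (exp_domination_number e <= #|S|)%N).
Proof.
rewrite /exp_domination_number.
case: arg_minnP => [|S dS minS]; first exact: exp_dominating_setT.
by split=> //; exists S.
Qed.

Definition log2 (R : realType) (x : R) : R := ln x / ln 2.

(* Main.v *)
(* Write k = #|S| and D = Delta - 1.  At most (D + 1) D^(d-1) vertices are at  *)
(* distance d from a given vertex, since paths do not backtrack.  Choose r     *)
(* with 2^(r-2) <= k < 2^(r-1): vertices of S at distance more than r from u   *)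
(* contribute less than 1/2 to the weight of u, so counting the remaining      *)
(* contributions from the side of S gives                                      *)
(*     n <= 2 k (2 + (D + 1) \sum_(j < r) (D / 2)^j).                          *)
(* For D >= 3 the geometric sum makes this O(D^2 k^L), with L = log2 D, and    *)
(* for D = 2 it is O(k log k) = O(k^(3/2)); in both cases the exponent is at   *)
(* most (L^2 + L + 1) / (L + 1) = L + 1 / (L + 1).                             *)

Require Import Defs.
From mathcomp Require Import all_boot all_order all_algebra.
From mathcomp Require Import boolp reals exp.
From mathcomp Require Import zify ring lra.

Import Order.TTheory GRing.Theory Num.Theory.

Local Open Scope ring_scope.

(** Double counting: the weights sum to at least n over all vertices, and exchanging sums lets each
    v in S be charged separately ([exp_dominating_order]). The restriction that paths avoid S is
    dropped, since an admissible path is still a simple path and hence places u in a [sphere] of v.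
    The discount 2^(1-d) against the growth of spheres leaves a geometric sum of ratio D/2, and
    cutting at radius about log2 k bounds n in terms of k alone. The sum is exponential in the
    radius for D >= 3 ([exp_dominating_order_ge4]) and linear for D = 2
    ([exp_dominating_order_eq3]). [le_powR_log2] converts the first bound into a power of k. *)

Section NonBacktracking.
Variables (T : finType) (e : rel T).

(* Endpoints of non-backtracking walks of length d that continue the edge     *)
(* from a to x.                                                               *)
Fixpoint nb_ends (d : nat) (a x : T) : {set T} :=
  if d is d'.+1 then \bigcup_(y in [set y | e x y] :\ a) nb_ends d' x y
  else [set x].

(* Contains every vertex at distance d from x, but possibly closer ones too.  *)
Definition sphere (x : T) (d : nat) : {set T} :=
  if d is d'.+1 then \bigcup_(y in [set y | e x y]) nb_ends d' x y
  else [set x].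

Lemma card_bigcup_le (A : {set T}) (F : T -> {set T}) (c : nat) :
  (forall y, y \in A -> #|F y| <= c)%N ->
  (#|\bigcup_(y in A) F y| <= #|A| * c)%N.
Proof.
move=> Fc; rewrite -sum_nat_const.
elim/big_rec2: _ => [|y n B yA]; first by rewrite cards0.
by move=> Bn; rewrite (leq_trans (leq_card_setU _ _)) // leq_add ?Fc.
Qed.

Lemma card_neighbours_le (x : T) : (#|[set y | e x y]| <= max_degree e)%N.
Proof. exact: (leq_bigmax (F := fun x => #|[set y | e x y]|)). Qed.

Hypothesis e_sym : symmetric e.

Lemma card_nb_ends_le (d : nat) (a x : T) :
  e a x -> (#|nb_ends d a x| <= (max_degree e).-1 ^ d)%N.
Proof.
elim: d a x => [|d IH] a x ax /=; first by rewrite cards1.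
rewrite expnS.
apply: (@leq_trans (#|[set y | e x y] :\ a| * (max_degree e).-1 ^ d)).
  apply: card_bigcup_le => y; rewrite !inE => /andP[_ xy]; exact: IH.
rewrite leq_mul2r; apply/orP; right.
(* The vertex [a] is itself a neighbour of [x], so removing it leaves at most Delta - 1. *)
have := card_neighbours_le x; rewrite (cardsD1 a) inE e_sym ax add1n.
by case: (max_degree e).
Qed.

Lemma card_sphere_le (x : T) (d : nat) :
  (#|sphere x d.+1| <= max_degree e * (max_degree e).-1 ^ d)%N.
Proof.
apply: (@leq_trans (#|[set y | e x y]| * (max_degree e).-1 ^ d)).
  by apply: card_bigcup_le => y; rewrite !inE => xy; apply: card_nb_ends_le.
by rewrite leq_mul2r card_neighbours_le orbT.
Qed.

Lemma nb_ends_path (a x : T) (p : seq T) :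
  path e x p -> uniq [:: a, x & p] -> last x p \in nb_ends (size p) a x.
Proof.
elim: p a x => [|y p IH] a x /=; first by rewrite inE.
case/andP=> xy yp /and3P[anp xnp yup]; apply/bigcupP; exists y.
  rewrite !inE xy andbT; apply: contraNneq anp => ->.
  by rewrite !inE eqxx orbT.
by apply: IH => //=; rewrite xnp.
Qed.

Lemma sphere_path (x : T) (p : seq T) :
  path e x p -> uniq (x :: p) -> last x p \in sphere x (size p).
Proof.
case: p => [|y p] /=; first by rewrite inE.
case/andP=> xy yp xup; apply/bigcupP; exists y; first by rewrite inE.
exact: nb_ends_path.
Qed.

(** A shortest admissible path from u is reversed, so that spheres are centred at vertices of S. *)
Lemma dist_sphere (S : {set T}) (u v : T) (d : nat) :
  dist e S u v = Some d -> u \in sphere v d.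
Proof.
rewrite /dist; case: pselect => // h [<-]; case: ex_minnP => {}d + _.
case/existsP=> p /and5P[ep /eqP pv up _ _].
have := sphere_path v (rev (belast u p)).
rewrite size_rev size_belast size_tuple -pv.
have -> : last (last u p) (rev (belast u p)) = u.
  case: (tval p) => //= y s; by rewrite rev_cons last_rcons.
apply; first by rewrite rev_path (eq_path (e' := e)) // => y z; rewrite e_sym.
by rewrite -rev_rcons -lastI rev_uniq.
Qed.

(** Spheres around v may overlap, so the sum over radii only dominates the one term at the true
    distance; distances beyond r are absorbed by the tail (1/2)^r. *)
Lemma half_pow_pred_sphere (S : {set T}) (u v : T) (r : nat) :
  half_pow_pred (dist e S u v)
    <= \sum_(d < r.+1) (u \in sphere v d)%:R * (1 / 2) ^ (d%:Z - 1)
       + (1 / 2) ^+ r.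
Proof.
rewrite /half_pow_pred; have : 1 / 2 <= 1 :> rat by lra.
have : 0 <= 1 / 2 :> rat by lra.
move: (1 / 2 : rat) => h h0 h1.
have pos (d : nat) : 0 <= (u \in sphere v d)%:R * h ^ (d%:Z - 1).
  by rewrite mulr_ge0 ?exprz_ge0.
case dE: (dist e S u v) => [d|]; last first.
  by rewrite addr_ge0 ?exprn_ge0 // sumr_ge0.
have [dr|rd] := leqP d r.
  rewrite (bigD1 (Ordinal (dr : d < r.+1)%N)) //= (dist_sphere _ _ _ _ dE) mul1r.
  by rewrite -[leRHS]addrA lerDl addr_ge0 ?exprn_ge0 // sumr_ge0.
case: d rd {dE} => // d; rewrite ltnS => rd.
rewrite intS [X in _ ^ X]addrAC subrr add0r -exprnP.
apply: (@le_trans _ _ (h ^+ r)); last by rewrite lerDr sumr_ge0.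
by rewrite ler_wiXn2l.
Qed.

Lemma sum_sphere_le (v : T) (r : nat) :
  \sum_(u : T) \sum_(d < r.+1) (u \in sphere v d)%:R * (1 / 2) ^ (d%:Z - 1)
    <= 2 + (max_degree e)%:R * \sum_(j < r) ((max_degree e).-1%:R / 2) ^+ j :> rat.
Proof.
have sum_mem (A : {set T}) : \sum_u (u \in A)%:R = #|A|%:R :> rat.
  by rewrite -sum1_card natr_sum [RHS]big_mkcond; apply: eq_bigr => u _; case: ifP.
rewrite exchange_big big_ord_recl /= lerD //.
  by rewrite -mulr_suml sum_mem cards1 sub0r exprN1 div1r invrK mul1r.
rewrite mulr_sumr; apply: ler_sum => d _.
rewrite -mulr_suml sum_mem.
have -> : (bump 0 d)%:Z - 1 = d by rewrite /bump add1n intS addrAC subrr add0r.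
rewrite -exprnP !expr_div_n expr1n div1r mulrA ler_wpM2r ?invr_ge0 ?exprn_ge0 //.
by rewrite -natrX -natrM ler_nat card_sphere_le.
Qed.

Lemma exp_dominating_order (S : {set T}) (r : nat) :
  exp_dominating e S ->
  #|T|%:R * (1 - #|S|%:R / 2 ^+ r)
    <= #|S|%:R * (2 + (max_degree e)%:R
                      * \sum_(j < r) ((max_degree e).-1%:R / 2) ^+ j) :> rat.
Proof.
move/forallP => dom.
have : #|T|%:R <= \sum_(u : T) weight e S u.
  by rewrite -sum1_card natr_sum; apply: ler_sum => u _; apply: dom.
rewrite /weight exchange_big /= => /le_trans le_n.
rewrite mulrBr mulr1 lerBlDr; apply: le_n.
apply: (@le_trans _ _ (\sum_(v in S) (2 + (max_degree e)%:R
    * \sum_(j < r) ((max_degree e).-1%:R / 2) ^+ j + #|T|%:R / 2 ^+ r))).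
  apply: ler_sum => v _.
  apply: le_trans (lerD (sum_sphere_le v r) (lexx _)).
  rewrite [in leRHS](_ : #|T|%:R / _ = \sum_(u : T) (1 / 2) ^+ r).
    by rewrite -big_split; apply: ler_sum => u _; apply: half_pow_pred_sphere.
  by rewrite sumr_const -[in LHS]mulr_natl mulr1 expr_div_n expr1n mul1r mulr_natl.
rewrite sumr_const -[leLHS]mulr_natl mulrDr lerD //.
by rewrite mulrCA mulrA.
Qed.

Lemma exp_dominating_gt0 (S : {set T}) (x : T) :
  exp_dominating e S -> (0 < #|S|)%N.
Proof.
move=> /forallP /(_ x); rewrite card_gt0; apply: contraTneq => ->.
by rewrite /weight big_set0 -ltNge.
Qed.

End NonBacktracking.

Lemma exp_dominating_order_trunc_log (T : finType) (e : rel T) (S : {set T}) :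
  symmetric e -> exp_dominating e S ->
  #|T|%:R <= 2 * #|S|%:R * (2 + (max_degree e)%:R
    * \sum_(j < (trunc_log 2 #|S|).+2) ((max_degree e).-1%:R / 2) ^+ j) :> rat.
Proof.
move=> e_sym dom; set m := trunc_log 2 #|S|.
(* Since k < 2^(m+1), radius r = m + 2 makes the total tail at most 1/2, which costs the factor
   2. *)
have far : #|S|%:R / 2 ^+ m.+2 <= 1 / 2 :> rat.
  rewrite ler_pdivrMr ?exprn_gt0 // exprS mulrA mul1r mulVf // mul1r.
  by rewrite -natrX ler_nat ltnW // trunc_log_ltn.
have := exp_dominating_order _ _ e_sym _ m.+2 dom.
set B := _ * (_ + _) => le_n; rewrite -mulrA -/B -ler_pdivrMl //.
apply: le_trans le_n; rewrite mulrC ler_wpM2l //; lra.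
Qed.

Lemma exp_dominating_order_ge4 (T : finType) (e : rel T) (S : {set T}) :
  symmetric e -> exp_dominating e S -> (4 <= max_degree e)%N ->
  (#|T| * 2 ^ trunc_log 2 #|S|
     <= 4 * #|S| * (max_degree e).-1 ^ (trunc_log 2 #|S|).+2)%N.
Proof.
move=> e_sym dom D4.
have := exp_dominating_order_trunc_log _ _ _ e_sym dom.
move: (trunc_log _ _) => m; case: (max_degree e) D4 => //= D D3.
set x : rat := D%:R / 2; set s := \sum_(_ < _) _ => le_n.
have xge : 3 / 2 <= x by rewrite ler_wpM2r // ler_nat.
have s0 : 0 <= s by apply: sumr_ge0 => j _; rewrite exprn_ge0 //; lra.
have sE : (x - 1) * s = x ^+ m.+2 - 1 by rewrite subrX1.
have DE : D.+1%:R = 2 * x + 1 :> rat by rewrite -natr1 /x; field.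
(* 2x + 1 <= 8(x - 1) exactly when x >= 3/2; the -8 then absorbs the additive 2 of the bound. *)
have xs : (2 * x + 1) * s <= 8 * x ^+ m.+2 - 8.
  have -> : 8 * x ^+ m.+2 - 8 = 8 * (x - 1) * s by rewrite -mulrA sE; ring.
  by rewrite ler_wpM2r //; lra.
rewrite -(ler_nat rat) 3!natrM !natrX.
have -> : D%:R = 2 * x by rewrite /x; field.
have -> : 4%:R * #|S|%:R * (2 * x) ^+ m.+2
    = 2 * #|S|%:R * (8 * x ^+ m.+2) * 2 ^+ m :> rat.
  by rewrite exprMn !exprS; ring.
rewrite ler_wpM2r ?exprn_ge0 //; apply: le_trans le_n _.
by rewrite ler_wpM2l ?mulr_ge0 // DE; lra.
Qed.

Lemma sqr_le_exp2 (m : nat) : ((3 * m + 8) ^ 2 <= 64 * 2 ^ m)%N.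
Proof.
elim: m => // m IH; rewrite [(2 ^ m.+1)%N]expnS.
apply: (@leq_trans (2 * (3 * m + 8) ^ 2)); last by rewrite [leqRHS]mulnCA leq_mul2l.
by rewrite -!mulnn; nia.
Qed.

Lemma exp_dominating_order_eq3 (T : finType) (e : rel T) (S : {set T}) :
  symmetric e -> exp_dominating e S -> max_degree e = 3 ->
  (#|T| ^ 2 <= 256 * #|S| ^ 3)%N.
Proof.
move=> e_sym dom D3; have [->//|/card_gt0P[x0 _]] := posnP #|T|.
have := exp_dominating_order_trunc_log _ _ _ e_sym dom.
have := trunc_logP (isT : 1 < 2)%N (exp_dominating_gt0 _ _ _ x0 dom).
move: (trunc_log _ _) => m; rewrite D3 /= divff // => le_m.
under eq_bigr do rewrite expr1n.
(* The ratio is 1, so the sum is m + 2 and the bracket is 2 + 3(m + 2) = 3m + 8. *)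
rewrite sumr_const card_ord -!natrM -natrD -natrM ler_nat => le_n.
have := sqr_le_exp2 m.
have {}le_n : (#|T| <= 2 * #|S| * (3 * m + 8))%N by apply: leq_trans le_n _; lia.
move: #|T| #|S| le_m le_n => n k le_m le_n le_sq.
apply: (@leq_trans ((2 * k * (3 * m + 8)) ^ 2)); first by rewrite leq_sqr.
rewrite expnMn; apply: (@leq_trans ((2 * k) ^ 2 * (64 * k))).
  by rewrite leq_mul2l; apply/orP; right; lia.
rewrite expnMn (expnS k 2); lia.
Qed.

(** Write k = t 2^m with t >= 1. Then k^L = t^L D^m, which is at least t D^m because L >= 1. *)
Lemma le_powR_log2 (R : realType) (k m D : nat) :
  (1 < D)%N -> (2 ^ m <= k)%N ->
  k%:R * D%:R ^+ m / 2 ^+ m <= k%:R `^ (log2 (D%:R)) :> R.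
Proof.
move=> D2 le_k; set L := log2 _.
have ln2 : 0 < ln (2 : R) by rewrite ln_gt0 // ltr1n.
have L1 : 1 <= L.
  by rewrite ler_pdivlMr // mul1r ler_ln ?posrE ?ltr0n ?ler_nat // ltnW.
have two_L : 2 `^ L = D%:R :> R.
  rewrite /powR pnatr_eq0 /= /L /log2 divfK ?gt_eqF // lnK // posrE ltr0n.
  exact: ltnW.
clearbody L; pose t : R := k%:R / 2 ^+ m.
have t1 : 1 <= t by rewrite ler_pdivlMr ?exprn_gt0 // mul1r -natrX ler_nat.
have -> : k%:R = t * 2 ^+ m by rewrite divfK // expf_neq0 // pnatr_eq0.
rewrite powRM ?exprn_ge0 //; last exact: le_trans t1.
rewrite -[2 ^+ m in leRHS]powR_mulrn // -powRrM [_ * L]mulrC powRrM two_L.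
rewrite powR_mulrn // mulrC.
have -> : (2 ^+ m)^-1 * (t * 2 ^+ m * D%:R ^+ m) = t * D%:R ^+ m.
  by field; rewrite expf_neq0 // pnatr_eq0.
rewrite ler_wpM2r ?exprn_ge0 //.
by rewrite -[leLHS]powRr1 ?(le_trans ler01 t1) // ler_powR.
Qed.

Theorem theorem2 (R : realType) (T : finType) (e : rel T)
    (e_sym : symmetric e) (e_irr : irreflexive e)
    (Delta_ge3 : (3 <= max_degree e)%N) :
  let n : R := #|T|%:R in
  let Delta : R := (max_degree e)%:R in
  let L : R := log2 (Delta - 1) in
  (n / (13 * (Delta - 1) ^+ 2)) `^ ((L + 1) / (L ^+ 2 + L + 1))
    <= (exp_domination_number e)%:R.
Proof.
lazy zeta; set n : R := #|T|%:R; set Delta : R := (max_degree e)%:R.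
set L := log2 _.
have [[S dom ->] _] := exp_domination_numberP e.
have [x0 _] : exists x : T, true.
  case: (pickP (@predT T)) => [x _|T0]; first by exists x.
  by move: Delta_ge3; rewrite /max_degree big_pred0.
have k1 : (1 : R) <= #|S|%:R by rewrite ler1n (exp_dominating_gt0 _ _ _ x0 dom).
have DE : Delta - 1 = (max_degree e).-1%:R.
  by rewrite /Delta -(prednK (ltnW (ltnW Delta_ge3))) -natr1 addrK.
have ln2 : 0 < ln (2 : R) by rewrite ln_gt0 // ltr1n.
have L1 : 1 <= L.
  rewrite /L DE ler_pdivlMr // mul1r ler_ln ?posrE ?ltr0n ?ler_nat //; lia.
have L2 : 0 < L ^+ 2 + L + 1 by rewrite -[_ + L + 1]addrA ltr_wpDl ?sqr_ge0 //; lra.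
pose q := (L ^+ 2 + L + 1) / (L + 1).
have q_inv : (L + 1) / (L ^+ 2 + L + 1) = q^-1 by rewrite invf_div.
have q_gt0 : 0 < q by rewrite divr_gt0 //; lra.
have qL : L <= q by rewrite ler_pdivlMr; [nra | lra].
have D0 : 0 < 13 * (Delta - 1) ^+ 2.
  by rewrite mulr_gt0 // exprn_gt0 // DE ltr0n; lia.
(* The exponent of the goal is 1/q, so raising to the power 1/q reduces it to a bound on n by
   k^q. *)
suff le_n : n / (13 * (Delta - 1) ^+ 2) <= #|S|%:R `^ q.
  have -> : #|S|%:R = (#|S|%:R `^ q) `^ q^-1.
    by rewrite -powRrM mulfV ?gt_eqF // powRr1 // (le_trans ler01).
  rewrite q_inv ge0_ler_powR ?invr_ge0 ?nnegrE ?powR_ge0 ?(ltW q_gt0) //.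
  by rewrite divr_ge0 ?ler0n ?(ltW D0).
rewrite ler_pdivrMr //.
have [D4|D3] := ltnP 3 (max_degree e).
- have := exp_dominating_order_ge4 _ _ _ e_sym dom D4.
  have := trunc_logP (isT : 1 < 2)%N (exp_dominating_gt0 _ _ _ x0 dom).
  move: (trunc_log _ _) => m le_m.
  rewrite -(ler_nat R) 3!natrM !natrX -ler_pdivlMr ?exprn_gt0 // -DE => le_n.
  apply: le_trans le_n _.
  have D1 : (1 < (max_degree e).-1)%N by lia.
  have := le_powR_log2 R _ _ _ D1 le_m; rewrite -DE -/L => kL.
  have kq : #|S|%:R `^ L <= #|S|%:R `^ q by rewrite ler_powR.
  (* The first factor is at most k^L, hence at most k^q; the second is at most 13 D^2. *)
  have -> : 4%:R * #|S|%:R * (Delta - 1) ^+ m.+2 / 2 ^+ m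
      = #|S|%:R * (Delta - 1) ^+ m / 2 ^+ m * (4 * (Delta - 1) ^+ 2).
    by rewrite !exprS; field; rewrite expf_neq0 // pnatr_eq0.
  apply: ler_pM (le_trans kL kq) _.
  + by rewrite !mulr_ge0 ?invr_ge0 ?exprn_ge0 // DE.
  + by rewrite mulr_ge0 ?sqr_ge0.
  + by rewrite ler_wpM2r ?sqr_ge0 // ler_nat.
(* Here L = 1 and q = 3/2; squaring removes the root and leaves 256 <= (13 * 2^2)^2. *)
- have {}D3 : max_degree e = 3 by lia.
  have := exp_dominating_order_eq3 _ _ _ e_sym dom D3.
  rewrite -(ler_nat R) natrM !natrX => le_n2.
  have L_eq1 : L = 1 by rewrite /L DE D3 /= /log2 divff // gt_eqF.
  have q2 : (#|S|%:R `^ q) ^+ 2 = #|S|%:R ^+ 3 :> R.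
    rewrite -powR_mulrn ?powR_ge0 // -powRrM -powR_mulrn ?ler0n //.
    by congr (_ `^ _); rewrite /q L_eq1; field.
  rewrite -(ler_pXn2r (isT : 0 < 2)%N) ?nnegrE ?ler0n //; last first.
    by rewrite mulr_ge0 ?powR_ge0 // ltW.
  rewrite exprMn q2 DE D3 /=; apply: le_trans le_n2 _.
  rewrite mulrC ler_wpM2l ?exprn_ge0 //; lra.
Qed.
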